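(* For every integer $d\geq 6$ with $d\notin\{7,11,13\}$ there exists an Anosov Lie algebra of dimension $d$ without a nonzero abelian factor.
   Context: A rational Lie algebra is a finite-dimensional Lie algebra over $\mathbb{Q}$. A rational Lie algebra $\mathfrak{n}$ of dimension $d$ is called Anosov if there exist a Lie algebra automorphism $A$ of $\mathfrak{n}$ and a basis $\beta$ of $\mathfrak{n}$ over $\mathbb{Q}$ such that $A$ is hyperbolic, i.e. all (complex) eigenvalues of $A$ have absolute value different from $1$, and the matrix $[A]_\beta$ of $A$ with respect to $\beta$ lies in $\mathrm{GL}(d,\mathbb{Z})$. A rational Lie algebra is without a nonzero abelian factor if it is not isomorphic to a direct sum of Lie algebras $\mathfrak{m}\oplus\mathbb{Q}^r$ with $r\geq 1$, where $\mathbb{Q}^r$ denotes the $r$-dimensional abelian Lie algebra. *)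

(* Defs.v *)
From HB Require Import structures.
From mathcomp Require Import all_boot all_order all_algebra.
From mathcomp Require Import complex.
From mathcomp Require Import Rstruct.

Set Implicit Arguments.
Unset Strict Implicit.
Unset Printing Implicit Defensive.

Import GRing.Theory Num.Theory.
Local Open Scope ring_scope.

HB.mixin Record Vector_isLieAlgebra (F : fieldType) L of Vector F L := {
  lie : L -> L -> L;
  lie_linearl : forall y : L, linear (lie^~ y);
  lie_linearr : forall x : L, linear (lie x);
  lie_alternating : forall x : L, lie x x = 0;
  lie_jacobi : forall x y z : L,
    lie x (lie y z) + lie y (lie z x) + lie z (lie x y) = 0
}.

(* A vectType is finite-dimensional, so these are the finite-dimensional
   Lie algebras over F. *)
#[short(type="lieAlgType")]
HB.structure Definition LieAlgebra (F : fieldType) :=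
  { L of Vector_isLieAlgebra F L & Vector F L }.

Definition is_lie_morphism (F : fieldType) (L M : lieAlgType F)
    (f : 'Hom(L, M)) : Prop :=
  forall x y : L, f (lie x y) = lie (f x) (f y).

Definition is_lie_isomorphism (F : fieldType) (L M : lieAlgType F)
    (f : 'Hom(L, M)) : Prop :=
  is_lie_morphism f /\ bijective f.

Definition lie_isomorphic (F : fieldType) (L M : lieAlgType F) : Prop :=
  exists f : 'Hom(L, M), is_lie_isomorphism f.

Section DirectSum.
Variables (F : fieldType) (L M : lieAlgType F).

Definition lie_prod (u v : L * M) : L * M := (lie u.1 v.1, lie u.2 v.2).

Fact lie_prod_linearl y : linear (lie_prod^~ y).
Proof. by move=> a u v; rewrite /lie_prod /= !lie_linearl. Qed.

Fact lie_prod_linearr x : linear (lie_prod x).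
Proof. by move=> a u v; rewrite /lie_prod /= !lie_linearr. Qed.

Fact lie_prod_alternating x : lie_prod x x = 0.
Proof. by rewrite /lie_prod !lie_alternating. Qed.

Fact lie_prod_jacobi x y z :
  lie_prod x (lie_prod y z) + lie_prod y (lie_prod z x)
    + lie_prod z (lie_prod x y) = 0.
Proof. by congr pair; rewrite /= lie_jacobi. Qed.

HB.instance Definition _ := Vector_isLieAlgebra.Build F (L * M)%type
  lie_prod_linearl lie_prod_linearr lie_prod_alternating lie_prod_jacobi.
End DirectSum.

(* An alias of 'rV[F]_r, so that the zero bracket is not made canonical on
   row vectors themselves. *)
Definition abelian_lie (F : fieldType) (r : nat) : Type := 'rV[F]_r.

Section Abelian.
Variables (F : fieldType) (r : nat).
Local Notation V := (abelian_lie F r).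

HB.instance Definition _ := Vector.copy V 'rV[F]_r.

Definition lie_zero (x y : V) : V := 0.

Fact lie_zero_linearl y : linear (lie_zero^~ y).
Proof. by move=> a u v; rewrite /lie_zero scaler0 addr0. Qed.

Fact lie_zero_linearr x : linear (lie_zero x).
Proof. by move=> a u v; rewrite /lie_zero scaler0 addr0. Qed.

Fact lie_zero_alternating x : lie_zero x x = 0.
Proof. by []. Qed.

Fact lie_zero_jacobi x y z :
  lie_zero x (lie_zero y z) + lie_zero y (lie_zero z x)
    + lie_zero z (lie_zero x y) = 0.
Proof. by rewrite /lie_zero !addr0. Qed.

HB.instance Definition _ := Vector_isLieAlgebra.Build F V
  lie_zero_linearl lie_zero_linearr lie_zero_alternating lie_zero_jacobi.
End Abelian.

Definition without_abelian_factor (F : fieldType) (L : lieAlgType F) : Prop :=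
  ~ exists (M : lieAlgType F) (r : nat),
      (1 <= r)%N /\ lie_isomorphic L (M * abelian_lie F r)%type.

(* Column j holds the coordinates of A b_j. *)
Definition matrix_in_basis (F : fieldType) (L : vectType F) n (b : n.-tuple L)
    (A : 'End(L)) : 'M[F]_n :=
  \matrix_(i, j) coord b i (A b`_j).

Definition Cplx : numClosedFieldType := Rdefinitions.R[i].

(* The eigenvalues of A (x) C on L (x) C; they do not depend on the basis, so
   the canonical one is used. *)
Definition complex_eigenvalue (L : vectType rat) (A : 'End(L))
    (a : Cplx) : Prop :=
  eigenvalue (map_mx (@ratr Cplx) (matrix_in_basis (vbasis {:L}) A)) a.

Definition hyperbolic (L : vectType rat) (A : 'End(L)) : Prop :=
  forall a : Cplx, complex_eigenvalue A a -> `|a| <> 1.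

Definition anosov (L : lieAlgType rat) : Prop :=
  exists (A : 'End(L)) (b : (\dim {:L}).-tuple L),
    [/\ is_lie_isomorphism A,
        basis_of {:L} b,
        hyperbolic A
      & exists2 Z : 'M[int]_(\dim {:L}),
          Z \in unitmx & matrix_in_basis b A = map_mx intr Z].

(* Main.v *)
Require Import Defs.
From HB Require Import structures.
From mathcomp Require Import all_boot all_order all_algebra.
From mathcomp Require Import ring.

Set Implicit Arguments.
Unset Strict Implicit.
Unset Printing Implicit Defensive.

Import GRing.Theory Num.Theory.
Local Open Scope ring_scope.

(** Every dimension in question is reached by direct sums of Lie algebras
    m (x) K, where m is a filiform rational Lie algebra, of any dimension at
    least 3, with basis x_0, ..., x_m and brackets [x_0, x_i] = x_(i+1) for
    1 <= i < m, and K = Q[x]/(x^n - x - 1) is seen as a Q-algebra of dimension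
    n >= 2.  Give x_i the weight i + 1; the bracket respects weights, so for a
    unit u of K, multiplication by u^(i+1) on the component x_i (x) K is an
    automorphism ([weighted_scale_lie]).

    For u the class eps of x, this automorphism preserves the lattice spanned
    by the vectors x_i (x) eps^j, and so does its inverse, because the inverse
    eps^(n-1) - 1 of eps is again an integral polynomial in eps.  It is
    hyperbolic because no root of x^n - x - 1 has absolute value 1
    ([selmer_root_norm]), hence neither has any power of such a root.  As
    every central element of m (x) K is a bracket ([filiform_center]), there
    is no abelian factor ([center_without_abelian_factor]).

    These properties pass to direct sums ([anosov_data_sum],
    [center_of_brackets_sum]).  Quadratic K give every even dimension from 6
    on, and the Heisenberg algebra over the cubic K gives 9.  An odd dimension
    d >= 15 is 9 + (d - 9), and the only odd dimensions above 6 not obtained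
    in this way are 7, 11 and 13.

    Complex eigenvalues are handled without complexifying L: a is an
    eigenvalue of A exactly when some nonzero additive map phi : L -> C
    satisfies phi (A x) = a * phi x. *)

(** * Anosov automorphisms in coordinates *)

Definition integral_coords (V : Type) (I : finType) (c : I -> V -> rat)
  (x : V) : Prop := forall i, c i x \is a Num.int.

(** The [c i] are the coordinate functions of a basis indexed by [I].  Stating
    this without naming the basis makes direct sums and spaces of functions
    immediate to treat. *)
Record coord_system (V : lmodType rat) (I : finType) (c : I -> V -> rat) :
    Prop := CoordSystem {
  coord_scalar : forall i, scalar (c i);
  coord_surj : forall g : I -> rat, exists x, forall i, c i x = g i;
  coord_inj : forall x, (forall i, c i x = 0) -> x = 0
}.

(** No eigenvalue of [A] on the complexification has absolute value 1: the map
    [phi] is an eigenvector of the transpose of [A].  Over a rational vector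
    space additive maps are automatically Q-linear. *)
Definition unit_free (C : numClosedFieldType) (V : zmodType) (A : V -> V) :
    Prop :=
  forall (a : C) (phi : V -> C), `|a| = 1 ->
    {morph phi : x y / x + y} -> (forall x, phi (A x) = a * phi x) ->
  forall x, phi x = 0.

(** The lattice is preserved by [A] and by its inverse [B], which replaces the
    condition that the determinant of an integer matrix be invertible. *)
Record anosov_data (L : lieAlgType rat) (I : finType) (c : I -> L -> rat)
    (A B : L -> L) : Prop := AnosovData {
  anosov_coord : coord_system c;
  anosov_linear : linear A;
  anosov_lie : forall x y, A (lie x y) = lie (A x) (A y);
  anosov_invl : cancel A B;
  anosov_invr : cancel B A;
  anosov_intA : forall x, integral_coords c x -> integral_coords c (A x);
  anosov_intB : forall x, integral_coords c x -> integral_coords c (B x);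
  anosov_unit_free : unit_free Cplx A
}.

Section Coordinates.
Variables (V : vectType rat) (I : finType) (c : I -> V -> rat).
Hypothesis cP : coord_system c.

Lemma coord_system_basis : exists b : #|I|.-tuple V,
  basis_of {:V} b /\ forall j x, coord b j x = c (enum_val j) x.
Proof.
have /fin_all_exists[e eP] (i : I) :
    exists x, forall j, c j x = (i == j)%:R := coord_surj cP _.
have cS (i : I) : {c' : {scalar V} | c' =1 c i}.
  pose ci : {scalar V} := HB.pack_for {scalar V} (c i)
    (GRing.isLinear.Build _ _ _ _ (c i) (coord_scalar cP i)).
  by exists ci.
have c_sum i n (u : 'I_n -> rat) (v : 'I_n -> V) :
    c i (\sum_j u j *: v j) = \sum_j u j * c i (v j).
  have [c' c'E] := cS i; rewrite -c'E raddf_sum.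
  by apply: eq_bigr => j _ /=; rewrite -c'E scalarZ.
have cB i x y : c i (x - y) = c i x - c i y.
  by have [c' c'E] := cS i; rewrite -!c'E raddfB.
pose b := [tuple e (enum_val j) | j < #|I|].
have bE (j : 'I_#|I|) : b`_j = e (enum_val j) by rewrite -tnth_nth tnth_mktuple.
have c_b u (j : 'I_#|I|) : c (enum_val j) (\sum_(i < #|I|) u i *: b`_i) = u j.
  rewrite c_sum (bigD1 j) //= bE eP eqxx mulr1 big1 ?addr0 // => i ne_ij.
  by rewrite bE eP (inj_eq enum_val_inj) (negPf ne_ij) mulr0.
have b_basis : basis_of {:V} b.
  apply/andP; split; last first.
    apply/freeP => u u0 j; rewrite -(c_b u j) u0.
    by have [c' c'E] := cS (enum_val j); rewrite -c'E raddf0.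
  rewrite eqEsubv subvf; apply/subvP => x _.
  have -> : x = \sum_(j < #|I|) c (enum_val j) x *: b`_j.
    apply/eqP; rewrite -subr_eq0; apply/eqP; apply: (coord_inj cP) => i.
    by rewrite cB -[i](enum_rankK i) c_b subrr.
  apply: rpred_sum => j _; apply: rpredZ; apply: memv_span.
  by rewrite mem_nth // size_tuple.
exists b; split=> // j x.
by rewrite [in RHS](coord_basis b_basis (memvf x)) c_b.
Qed.

End Coordinates.

Lemma matrix_in_basisM (V : vectType rat) n (b : n.-tuple V) (A B : 'End(V)) :
  basis_of {:V} b ->
  matrix_in_basis b (A \o B)%VF = matrix_in_basis b A *m matrix_in_basis b B.
Proof.
move=> bP; apply/matrixP => i j; rewrite !mxE lfunE /=.
rewrite [B b`_j](coord_basis bP (memvf _)) !linear_sum /=.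
by apply: eq_bigr => k _; rewrite !mxE !linearZ /= mulrC.
Qed.

Lemma matrix_in_basis1 (V : vectType rat) n (b : n.-tuple V) :
  basis_of {:V} b -> matrix_in_basis b \1%VF = 1%:M.
Proof.
move=> bP; apply/matrixP => i j; rewrite !mxE lfunE /=.
by rewrite coord_free ?(basis_free bP) // eq_sym.
Qed.

(** A row eigenvector [v] of the matrix of [A] is the list of values on the
    basis of the linear form [phi] with [phi \o A = a * phi], so the
    eigenvalues do not depend on the basis. *)
Lemma unit_free_eigenvalue (C : numClosedFieldType) (V : vectType rat) n
    (b : n.-tuple V) (A : 'End(V)) (a : C) :
    basis_of {:V} b -> unit_free C A ->
  eigenvalue (map_mx ratr (matrix_in_basis b A)) a -> `|a| <> 1.
Proof.
move=> bP Afree /eigenvalueP[v vA v_neq0] a1.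
pose phi (x : V) : C := \sum_i v 0 i * ratr (coord b i x).
have phi_D : {morph phi : x y / x + y}.
  move=> x y; rewrite -big_split; apply: eq_bigr => i _.
  by rewrite linearD /= rmorphD mulrDr.
have phi_A x : phi (A x) = a * phi x.
  pose F i j := v 0 i * ratr (matrix_in_basis b A i j) * ratr (coord b j x).
  transitivity (\sum_i \sum_j F i j).
    apply: eq_bigr => i _; rewrite [x in LHS](coord_basis bP (memvf _)).
    rewrite !linear_sum rmorph_sum mulr_sumr; apply: eq_bigr => j _ /=.
    by rewrite /F mxE !linearZ rmorphM /= mulrA mulrAC.
  rewrite exchange_big mulr_sumr; apply: eq_bigr => j _; rewrite -mulr_suml.
  rewrite [RHS]mulrA; congr (_ * ratr _); have /rowP/(_ j) := vA.
  by rewrite !mxE => <-; apply: eq_bigr => i _; rewrite !mxE.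
case/eqP: v_neq0; apply/rowP => j; rewrite mxE.
have := Afree a phi a1 phi_D phi_A b`_j.
rewrite /phi (bigD1 j) //= big1 ?addr0.
  by rewrite coord_free ?(basis_free bP) // eqxx rmorph1 mulr1.
move=> i ne_ij; rewrite coord_free ?(basis_free bP) // eq_sym (negPf ne_ij).
by rewrite rmorph0 mulr0.
Qed.

(** The integer matrices of [A] and [B] are inverse to each other, so both are
    invertible over the integers. *)
Lemma anosov_of_basis (L : lieAlgType rat) n (b : n.-tuple L) (A B : 'End(L)) :
    is_lie_morphism A -> cancel A B -> cancel B A -> basis_of {:L} b ->
    (forall i j, matrix_in_basis b A i j \is a Num.int) ->
    (forall i j, matrix_in_basis b B i j \is a Num.int) ->
    unit_free Cplx A -> anosov L.
Proof.
move=> Alie AK BK bP Aint Bint Afree; have n_dim := size_basis bP; subst n.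
exists A, b; split=> //; first by split=> //; exists B.
  by move=> a; apply: unit_free_eigenvalue => //; apply: vbasisP.
pose Z (C : 'End(L)) : 'M[int]__ := map_mx Num.floor (matrix_in_basis b C).
have ZE C : (forall i j, matrix_in_basis b C i j \is a Num.int) ->
    matrix_in_basis b C = map_mx intr (Z C).
  by move=> Cint; apply/matrixP => i j; rewrite [RHS]mxE [in RHS]mxE floorK.
exists (Z A); last exact: ZE.
suff /mulmx1_unit[] : Z A *m Z B = 1%:M by [].
have ZAB : map_mx intr (Z A *m Z B) = 1%:M :> 'M[rat]__.
  rewrite map_mxM -!ZE // -matrix_in_basisM // -(matrix_in_basis1 bP).
  by congr matrix_in_basis; apply/lfunP => x; rewrite !lfunE /= BK.
apply/matrixP => i j; apply: (@intr_inj rat).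
by have /matrixP/(_ i j) := ZAB; rewrite mxE => ->; rewrite !mxE; case: eqP.
Qed.

Lemma anosov_of_data (L : lieAlgType rat) (I : finType) (c : I -> L -> rat)
    (A B : L -> L) : anosov_data c A B -> \dim {:L} = #|I| /\ anosov L.
Proof.
case=> cP Alin Alie AK BK Aint Bint Afree.
have [b [bP bE]] := coord_system_basis cP.
split; first exact: size_basis bP.
have Blin : linear B.
  by move=> k x y; apply: (can_inj AK); rewrite Alin !BK.
pose Al : {linear L -> L} := HB.pack A (GRing.isLinear.Build _ _ _ _ A Alin).
pose Bl : {linear L -> L} := HB.pack B (GRing.isLinear.Build _ _ _ _ B Blin).
have AE : linfun Al =1 A by move=> x; rewrite lfunE.
have BE : linfun Bl =1 B by move=> x; rewrite lfunE.
have b_int (j : 'I_#|I|) : integral_coords c b`_j.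
  move=> i; rewrite -[i](enum_rankK i) -bE coord_free ?(basis_free bP) //.
apply: (@anosov_of_basis _ _ b (linfun Al) (linfun Bl)) => //.
- by move=> x y; rewrite !AE Alie.
- by move=> x; rewrite AE BE AK.
- by move=> x; rewrite AE BE BK.
- by move=> i j; rewrite mxE AE bE; apply: Aint.
- by move=> i j; rewrite mxE BE bE; apply: Bint.
move=> a phi a1 phiD phiA; apply: (Afree a) => // x; by rewrite -AE.
Qed.

(** This is stronger than the inclusion of the center in the derived algebra,
    and it is visibly stable under direct sums. *)
Definition center_of_brackets (L : lieAlgType rat) : Prop :=
  forall z : L, (forall y, lie z y = 0) -> exists x y, z = lie x y.

(** A nonzero element of an abelian factor is central, while the projection of
    any bracket to that factor vanishes. *)
Lemma center_without_abelian_factor (L : lieAlgType rat) :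
  center_of_brackets L -> without_abelian_factor L.
Proof.
move=> Lcenter [M [[|r] [//_ [f [f_lie f_bij]]]]].
have [g fK gK] := f_bij.
pose v : abelian_lie rat r.+1 := const_mx (1 : rat) : 'rV[rat]_r.+1.
have [y|x [y xy]] := Lcenter (g (0, v)).
  apply: (can_inj fK); rewrite f_lie gK linear0; congr pair => /=.
  have := lie_linearl (f y).1 (- 1) 0 0.
  by rewrite scaler0 addr0 scaleN1r addNr.
have := congr1 (fun u => (f u).2) xy; rewrite f_lie gK /=.
move/(congr1 (fun u : 'rV[rat]_r.+1 => u 0 0)); rewrite !mxE => /eqP.
by rewrite oner_eq0.
Qed.

(** * Direct sums *)

Section DirectSum.
Variables (L M : lieAlgType rat).

Definition coord_sum (I J : Type) (c : I -> L -> rat) (d : J -> M -> rat)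
    (s : I + J) (x : L * M) : rat :=
  match s with inl i => c i x.1 | inr j => d j x.2 end.

Lemma anosov_data_sum (I J : finType) (c : I -> L -> rat) (d : J -> M -> rat)
    (A B : L -> L) (A' B' : M -> M) :
    anosov_data c A B -> anosov_data d A' B' ->
  @anosov_data (L * M)%type (I + J)%type (coord_sum c d)
    (fun x => (A x.1, A' x.2)) (fun x => (B x.1, B' x.2)).
Proof.
move=> [[c_lin c_surj c_inj] Alin Alie AK BK Aint Bint Afree].
move=> [[d_lin d_surj d_inj] A'lin A'lie A'K B'K A'int B'int A'free].
split=> /=.
- split=> [[i|j] k x y|g|[x y] xy0] /=; [exact: c_lin|exact: d_lin| |].
    have [x xE] := c_surj (fun i => g (inl i)).
    have [y yE] := d_surj (fun j => g (inr j)).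
    by exists (x, y) => -[i|j] /=.
  congr pair; first by apply: c_inj => i; apply: (xy0 (inl i)).
  by apply: d_inj => j; apply: (xy0 (inr j)).
- by move=> k x y; rewrite /= Alin A'lin.
- by move=> x y; rewrite Alie A'lie.
- by move=> [x y]; rewrite /= AK A'K.
- by move=> [x y]; rewrite /= BK B'K.
- move=> x x_int [i|j]; first by apply: Aint => k; apply: (x_int (inl k)).
  by apply: A'int => k; apply: (x_int (inr k)).
- move=> x x_int [i|j]; first by apply: Bint => k; apply: (x_int (inl k)).
  by apply: B'int => k; apply: (x_int (inr k)).
have A0 : A 0 = 0.
  by have := Alin (- 1) 0 0; rewrite scaler0 addr0 scaleN1r addNr.
have A'0 : A' 0 = 0.
  by have := A'lin (- 1) 0 0; rewrite scaler0 addr0 scaleN1r addNr.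
move=> a phi a1 phiD phiA [x y].
have -> : (x, y) = (x, 0) + (0, y) by congr pair; rewrite ?addr0 ?add0r.
rewrite phiD (Afree a (fun x => phi (x, 0))) //; last 2 first.
- by move=> u v; rewrite -phiD; congr phi; congr pair; rewrite addr0.
- by move=> u; rewrite -phiA /= A'0.
rewrite (A'free a (fun y => phi (0, y))) ?addr0 //.
- by move=> u v; rewrite -phiD; congr phi; congr pair; rewrite addr0.
- by move=> u; rewrite -phiA /= A0.
Qed.

Lemma center_of_brackets_sum : center_of_brackets L -> center_of_brackets M ->
  center_of_brackets (L * M)%type.
Proof.
move=> Lc Mc [z w] zw0.
have [y|x [y ->]] := Lc z; first by have [] := zw0 (y, 0).
have [y'|x' [y' ->]] := Mc w; first by have [] := zw0 (0, y').
by exists (x, x'), (y, y').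
Qed.

End DirectSum.

(** * Powers of a map without eigenvalues of absolute value 1 *)

Section UnitFree.
Variables (C : numClosedFieldType) (V : zmodType) (T : V -> V).
Hypothesis T_additive : {morph T : x y / x + y}.

Let shift (b : C) (phi : V -> C) (x : V) : C := phi (T x) - b * phi x.

(** Composing the operators T^* - b, for b in [bs], applies to [phi] the
    polynomial with roots [bs] evaluated at the transpose T^* of [T]. *)
Lemma foldr_shift phi (bs : seq C) x :
  foldr shift phi bs x =
    \sum_(i < (size bs).+1) (\prod_(b <- bs) ('X - b%:P))`_i * phi (iter i T x).
Proof.
elim: bs x => [|b bs IHbs] x.
  by rewrite big_ord1 big_nil coef1 mul1r.
rewrite big_cons [LHS]/= /shift !IHbs.
set p := \prod_(b <- bs) _; set n := (size bs).+1.
have p_n : p`_n = 0 by rewrite nth_default // size_prod_XsubC.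
rewrite (eq_bigr (fun i : 'I_n.+1 => ('X * p)`_i * phi (iter i T x) -
    b * (p`_i * phi (iter i T x)))); last first.
  by move=> i _; rewrite mulrBl coefB coefCM mulrBl mulrA.
rewrite sumrB -mulr_sumr; congr (_ - b * _); last first.
  by rewrite [RHS]big_ord_recr /= p_n mul0r addr0.
rewrite [RHS]big_ord_recl coefXM mul0r add0r; apply: eq_bigr => i _.
by rewrite coefXM /= -iterSr.
Qed.

(** If a is an eigenvalue of T^s then, as X^s - a splits into factors X - b
    with b^s = a, some such b is an eigenvalue of T, and |b| = 1 when
    |a| = 1. *)
Lemma unit_free_iter s : (0 < s)%N -> unit_free C T -> unit_free C (iter s T).
Proof.
move=> s_gt0 Tfree a phi a1 phiD phiT.
have [r rE] := closed_field_poly_normal ('X^s - a%:P).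
move: rE; rewrite lead_coefXnsubC // scale1r => rE.
have r_size : size r = s.
  by apply: succn_inj; rewrite -(size_prod_XsubC _ id) -rE size_XnsubC.
have r1 b : b \in r -> `|b| = 1.
  rewrite -root_prod_XsubC -rE rootE !hornerE subr_eq0 => /eqP ba.
  by apply/eqP; rewrite -(pexpr_eq1 s_gt0) // -normrX ba a1.
have phi_r x : foldr shift phi r x = 0.
  rewrite foldr_shift -rE r_size big_ord_recr.
  rewrite (bigD1 (Ordinal s_gt0)) //= big1 => [|i i_neq0].
    rewrite !coefB !coefXn !coefC eqxx eq_sym (gtn_eqF s_gt0) phiT /=.
    by rewrite addr0 subr0 sub0r mul1r mulNr addNr.
  rewrite coefB coefXn coefC (ltn_eqF (ltn_ord i)) ifN ?subrr ?mul0r //.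
elim: r r1 phi_r {r_size rE} => [|b r IHr] r1 phi_r x; first exact: phi_r.
apply: IHr => [b' b'r|y]; first by apply: r1; rewrite inE b'r orbT.
apply: (Tfree b) => [|u v|u].
- by apply: r1; rewrite mem_head.
- elim: r {r1 phi_r} u v => [|c bs IHbs] u v; first exact: phiD.
  by rewrite /= /shift T_additive !IHbs; ring.
- by apply/eqP; rewrite -subr_eq0; apply/eqP; apply: phi_r.
Qed.

End UnitFree.

(** * The algebra Q[x]/(x^n - x - 1) *)

(** If z has absolute value 1 then so has z + 1, being z^n.  This forces z to
    be a primitive cube root of unity; then z^n is a cube root of unity, but
    z + 1 = - z^2 is not. *)
Lemma selmer_root_norm (C : numClosedFieldType) n (z : C) :
  z ^+ n = z + 1 -> `|z| <> 1.
Proof.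
move=> zn z1.
have zz : z * z^* = 1 by rewrite -normCK z1 expr1n.
have ww : (z + 1) * (z^* + 1) = 1.
  have <- : (z + 1)^* = z^* + 1 by rewrite rmorphD rmorph1.
  by rewrite -normCK -zn normrX z1 !expr1n.
have z2 : z ^+ 2 + z + 1 = 0.
  (* zz and ww give z + z^* + 1 = 0; multiplying by z and using zz again
     yields the quadratic equation. *)
  transitivity (z * ((z + 1) * (z^* + 1) - z * z^*) - z * z^* + 1).
    by ring.
  by rewrite ww zz; ring.
have z3 : z ^+ 3 = 1.
  apply/eqP; rewrite -subr_eq0; apply/eqP.
  by transitivity ((z - 1) * (z ^+ 2 + z + 1)); [ring | rewrite z2 mulr0].
have w3 : (z + 1) ^+ 3 = - 1.
  have -> : z + 1 = - z ^+ 2 by apply/eqP; rewrite -addr_eq0 addrC addrA z2.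
  by rewrite exprNn -exprM mulnC exprM z3 expr1n mulr1; ring.
have := w3; rewrite -zn -exprM mulnC exprM z3 expr1n => /eqP.
by rewrite -addr_eq0 (pnatr_eq0 C 2).
Qed.

Section FiniteFunctions.
Variables (J : finType) (V : vectType rat) (I : finType) (c : I -> V -> rat).

Definition coord_ffun (ji : J * I) (f : {ffun J -> V}) : rat :=
  c ji.2 (f ji.1).

Lemma coord_system_ffun : coord_system c -> coord_system coord_ffun.
Proof.
case=> c_lin c_surj c_inj; split=> [[j i] k f g|g|f f0].
- by rewrite /coord_ffun /= !ffunE c_lin.
- have /fin_all_exists[x xE] (j : J) :
    exists x, forall i, c i x = g (j, i) := c_surj (fun i => g (j, i)).
  by exists (finfun x) => -[j i]; rewrite /coord_ffun /= ffunE xE.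
by apply/ffunP => j; rewrite ffunE; apply: c_inj => i; apply: (f0 (j, i)).
Qed.

End FiniteFunctions.

Definition coord_npoly n (i : 'I_n) (p : {poly_n rat}) : rat :=
  (p : {poly rat})`_i.

Lemma coord_system_npoly n : coord_system (@coord_npoly n).
Proof.
split=> [i k p q|g|p p0].
- by rewrite /coord_npoly /= coefD coefZ.
- exists (mk_npoly n (fun i => oapp g 0 (insub i))) => i.
  by rewrite /coord_npoly /= coef_poly ltn_ord valK.
apply: val_inj; apply/polyP => i /=; rewrite coef0.
have [i_lt|n_le] := ltnP i n; first exact: (p0 (Ordinal i_lt)).
exact: big_coef_npoly.
Qed.

(** The exponent is shifted so that the degree is at least 2 for every [k]. *)
Definition selmer k : {poly rat} := 'X^(k.+2) - ('X + 1).

Section Selmer.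
Variable k : nat.
Local Notation h := (selmer k).
Local Notation K := {poly %/ h}.
Local Notation eps := (qpolyX h).

Lemma size_selmer : size h = k.+3.
Proof. by rewrite size_polyDl ?size_polyXn // size_polyN size_XaddC. Qed.

Lemma monic_selmer : h \is monic.
Proof.
rewrite monicE lead_coefDl ?lead_coefXn //.
by rewrite size_polyXn size_polyN size_XaddC.
Qed.

Lemma mk_monic_selmer : mk_monic h = h.
Proof. by rewrite /mk_monic size_selmer monic_selmer. Qed.

Lemma in_qpoly_selmer : in_qpoly h h = 0.
Proof. apply: val_inj.
by rewrite /= mk_monic_selmer Pdiv.RingMonic.rmodpp ?monic_selmer. Qed.

Lemma selmer_eps : eps ^+ k.+2 = eps + 1.
Proof.
apply/eqP; rewrite -subr_eq0 -in_qpoly_selmer.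
by rewrite rmorphB rmorphD rmorph1 rmorphXn.
Qed.

(** The relation eps^(k+2) = eps + 1 reads (eps^(k+1) - 1) * eps = 1. *)
Definition eps_inv : K := eps ^+ k.+1 - 1.

Lemma eps_invl : eps_inv * eps = 1.
Proof. by rewrite mulrBl -exprSr selmer_eps mul1r addrC addKr. Qed.

Definition integral (u : K) : Prop := integral_coords (@coord_npoly _) u.

Lemma integral_coef (u : K) i : integral u -> (u : {poly rat})`_i \is a Num.int.
Proof.
move=> u_int; have [i_lt|n_le] := ltnP i (size (mk_monic h)).-1.
  exact: (u_int (Ordinal i_lt)).
by rewrite big_coef_npoly.
Qed.

(** Multiplication by [eps] shifts the coefficients and removes the one
    overflowing term with the help of [h], so it is given by an integer
    matrix. *)
Lemma eps_mulE (u : K) :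
  eps * u = 'X * (u : {poly rat}) - (u : {poly rat})`_k.+1 *: h :> {poly rat}.
Proof.
set p := 'X * _ - _.
have -> : eps * u = in_qpoly h p.
  rewrite linearB linearZ /= in_qpoly_selmer scaler0 subr0 rmorphM /=.
  congr (_ * _); apply: val_inj; exact: esym (in_qpoly_small (size_mk_monic u)).
apply: in_qpoly_small; rewrite mk_monic_selmer size_selmer ltnS.
apply/leq_sizeP => i; rewrite leq_eqVlt coefB coefXM coefZ.
case/orP=> [/eqP <-|k2_lt].
  have -> : h`_k.+2 = 1 by rewrite coefB coefD coefXn coefX coef1 eqxx.
  by rewrite mulr1 subrr.
rewrite [h`_i]nth_default ?size_selmer // mulr0 subr0.
case: i k2_lt => //= i k1_lt; apply: big_coef_npoly.
by rewrite mk_monic_selmer size_selmer.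
Qed.

Lemma integral_eps u : integral u -> integral (eps * u).
Proof.
move=> u_int i; rewrite /coord_npoly eps_mulE coefB coefXM coefZ.
have h_int : h`_i \is a Num.int.
  by rewrite coefB coefD coefXn coefX coef1 !(rpredB, rpredD, rpred_nat).
by apply: rpredB; [case: eqP => // _|apply: rpredM => //]; apply: integral_coef.
Qed.

Lemma integral_epsX n u : integral u -> integral (eps ^+ n * u).
Proof.
move=> u_int; elim: n => [|n IHn]; first by rewrite mul1r.
by rewrite exprS -mulrA; apply: integral_eps.
Qed.

Lemma integral_eps_inv u : integral u -> integral (eps_inv * u).
Proof.
move=> u_int i; rewrite mulrBl mul1r /coord_npoly coefB.
by apply: rpredB; last exact: u_int; apply: integral_epsX.
Qed.

Lemma integral_eps_invX n u : integral u -> integral (eps_inv ^+ n * u).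
Proof.
move=> u_int; elim: n => [|n IHn]; first by rewrite mul1r.
by rewrite exprS -mulrA; apply: integral_eps_inv.
Qed.

(** An eigenvalue b of multiplication by [eps] satisfies b^(k+2) = b + 1,
    so |b| <> 1; powers of [eps] follow by [unit_free_iter]. *)
Lemma eps_unit_free (C : numClosedFieldType) n :
  (0 < n)%N -> unit_free C (fun u : K => eps ^+ n * u).
Proof.
move=> n_gt0 a phi a1 phiD phi_eps.
apply: (@unit_free_iter _ _ ( *%R eps) _ n n_gt0 _ a) => // [u v||u].
- exact: mulrDr.
- move=> b chi b1 chiD chi_eps u.
  have chiX m v : chi (eps ^+ m * v) = b ^+ m * chi v.
    elim: m => [|m IHm]; first by rewrite !mul1r.
    by rewrite exprS -mulrA chi_eps IHm exprS mulrA.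
  have : (b ^+ k.+2 - (b + 1)) * chi u = 0.
    rewrite mulrBl -chiX selmer_eps mulrDl mul1r chiD chi_eps mulrDl mul1r.
    exact: subrr.
  move/eqP; rewrite mulf_eq0 => /orP[|/eqP //].
  by rewrite subr_eq0 => /eqP/selmer_root_norm.
by rewrite -phi_eps; congr phi; elim: {n_gt0 phi_eps} n => [|n IHn];
  rewrite ?mul1r //= IHn exprS mulrA.
Qed.

End Selmer.

(** * Filiform Lie algebras over Q[x]/(h) *)

(** The element [f] stands for the sum of the x_i (x) f i, for i from 0 to
    m. *)
Definition filiform (h : {poly rat}) (m : nat) : Type :=
  {ffun 'I_m.+1 -> {poly %/ h}}.

Section Filiform.
Variables (h : {poly rat}) (m : nat).
Local Notation L := (filiform h m).
Local Notation K := {poly %/ h}.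

HB.instance Definition _ := Vector.copy L {ffun 'I_m.+1 -> {poly %/ h}}.

Definition ord_prev (i : 'I_m.+1) : 'I_m.+1 := inord i.-1.

Lemma ord_prevE (i : 'I_m.+1) : ord_prev i = i.-1 :> nat.
Proof. by rewrite inordK // (leq_ltn_trans (leq_pred i)). Qed.

(** From [x_0, x_j] = x_(j+1) for j >= 1, the x_i-component of a bracket is
    nonzero only if i >= 2, and then it comes from x_0 and x_(i-1). *)
Definition filiform_lie (f g : L) : L :=
  [ffun i : 'I_m.+1 => if (1 < i)%N
    then f ord0 * g (ord_prev i) - g ord0 * f (ord_prev i) else 0 : K].

Fact filiform_lie_linearr f : linear (filiform_lie f).
Proof.
move=> a g1 g2; apply/ffunP => i; rewrite !ffunE.
case: ifP => _; last by rewrite scaler0 addr0.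
rewrite mulrDr mulrDl -scalerAr -scalerAl scalerBr.
by rewrite opprD addrACA.
Qed.

Fact filiform_lie_anti f g : filiform_lie f g = - filiform_lie g f.
Proof.
by apply/ffunP => i; rewrite !ffunE; case: ifP => _; rewrite ?oppr0 ?opprB.
Qed.

Fact filiform_lie_linearl g : linear (filiform_lie^~ g).
Proof.
move=> a f1 f2; rewrite /= filiform_lie_anti filiform_lie_linearr.
by rewrite opprD -scalerN -!filiform_lie_anti.
Qed.

Fact filiform_lie_alternating f : filiform_lie f f = 0.
Proof.
by apply/ffunP => i; rewrite !ffunE subrr; case: ifP.
Qed.

Fact filiform_lie_jacobi f1 f2 f3 :
  filiform_lie f1 (filiform_lie f2 f3) + filiform_lie f2 (filiform_lie f3 f1)
    + filiform_lie f3 (filiform_lie f1 f2) = 0.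
Proof.
apply/ffunP => i; rewrite !ffunE /=.
case: ifP => _; last by rewrite !addr0.
case: ifP => _; last by rewrite !mulr0 !mul0r !subr0 !addr0.
ring.
Qed.

HB.instance Definition _ := Vector_isLieAlgebra.Build rat L
  filiform_lie_linearl filiform_lie_linearr filiform_lie_alternating
  filiform_lie_jacobi.

Definition filiform_gen (j : 'I_m.+1) (u : K) : L :=
  [ffun i => if i == j then u else 0].

Lemma filiform_sum (f : L) : f = \sum_j filiform_gen j (f j).
Proof.
apply/ffunP => i; rewrite sum_ffunE (bigD1 i) //= big1 ?addr0 => [|j ne_ji].
  by rewrite ffunE eqxx.
by rewrite ffunE eq_sym (negPf ne_ji).
Qed.

(** Bracketing a central element with x_1 shows that its x_0-component is
    zero, and bracketing with x_0 that only its x_m-component can be nonzero;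
    but u x_m = [x_0, u x_(m-1)].  The bound on m ensures that
    m - 1 is not 0. *)
Lemma filiform_center : (1 < m)%N -> center_of_brackets L.
Proof.
move=> m_gt1 z z0.
have zE i y : filiform_lie z y i = 0.
  by have := z0 y; rewrite /lie /= => ->; rewrite ffunE.
pose i1 : 'I_m.+1 := inord 1; pose i2 : 'I_m.+1 := inord 2.
have i1E : i1 = 1%N :> nat by rewrite inordK // ltnW.
have i2E : i2 = 2%N :> nat by rewrite inordK.
have prev2 : ord_prev i2 = i1 by apply: val_inj; rewrite /= ord_prevE i2E.
have z_0 : z ord0 = 0.
  have := zE i2 (filiform_gen i1 1); rewrite !ffunE i2E prev2 eqxx /=.
  by rewrite -val_eqE /= i1E mul0r subr0 mulr1.
have z_mid (j : 'I_m.+1) : (j < m)%N -> z j = 0.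
  move=> j_lt; have [j0|j_gt0] := posnP j.
    by rewrite -z_0; congr (z _); apply: val_inj.
  have sj : (j.+1 < m.+1)%N by [].
  have := zE (Ordinal sj) (filiform_gen ord0 1); rewrite !ffunE /= ltnS j_gt0.
  have -> : ord_prev (Ordinal sj) = j by apply: val_inj; rewrite /= ord_prevE.
  rewrite -val_eqE /= (gtn_eqF j_gt0) mulr0 mul1r sub0r => /eqP.
  by rewrite oppr_eq0 => /eqP.
exists (filiform_gen ord0 1), (filiform_gen (ord_prev ord_max) (z ord_max)).
rewrite /lie /=; apply/ffunP => i; rewrite !ffunE eqxx mul1r.
have -> : (ord0 == ord_prev ord_max) = false.
  by rewrite -val_eqE /= ord_prevE /= eq_sym gtn_eqF // -ltnS prednK // ltnW.
rewrite mul0r subr0; case: ltnP => [i_gt1|i_le1]; last first.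
  by apply: z_mid; apply: leq_ltn_trans i_le1 m_gt1.
rewrite -val_eqE /= !ord_prevE /=.
have -> : (i.-1 == m.-1) = (i == ord_max).
  by rewrite -val_eqE /= -eqSS !prednK // ltnW.
case: eqP => [-> //|ne_im]; apply: z_mid.
rewrite ltn_neqAle -ltnS ltn_ord andbT; apply/eqP => im.
by apply: ne_im; apply: val_inj.
Qed.

Definition weighted_scale (u : K) (f : L) : L :=
  [ffun i : 'I_m.+1 => u ^+ i.+1 * f i].

Lemma weighted_scale_linear u : linear (weighted_scale u).
Proof. by move=> a f g; apply/ffunP => i; rewrite !ffunE mulrDr scalerAr. Qed.

(** The weight 1 of x_0 and the weight i of x_(i-1) add up to the weight i + 1
    of x_i. *)
Lemma weighted_scale_lie u f g :
  weighted_scale u (lie f g) = lie (weighted_scale u f) (weighted_scale u g).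
Proof.
apply/ffunP => i; rewrite /lie /= !ffunE.
case: ifP => [i_gt1|_]; last exact: mulr0.
by rewrite ord_prevE prednK ?(ltnW i_gt1) // exprS expr1; ring.
Qed.

Lemma weighted_scaleK u v : v * u = 1 ->
  cancel (weighted_scale u) (weighted_scale v).
Proof.
by move=> vu f; apply/ffunP => i; rewrite !ffunE mulrA -exprMn vu expr1n mul1r.
Qed.

(** The map preserves each component x_j (x) K, and acts there by u^(j+1). *)
Lemma weighted_scale_unit_free (C : numClosedFieldType) u :
    (forall n, (0 < n)%N -> unit_free C (fun v : K => u ^+ n * v)) ->
  unit_free C (weighted_scale u).
Proof.
move=> u_free a phi a1 phiD phi_u f; rewrite (filiform_sum f).
have phi0 : phi 0 = 0.
  by apply/eqP; rewrite -(inj_eq (addrI (phi 0))) -phiD !addr0.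
rewrite (big_morph phi phiD phi0); apply: big1 => j _.
apply: (u_free j.+1 _ a (fun v => phi (filiform_gen j v))) => // [v w|v].
  rewrite -phiD; congr phi; apply/ffunP => i; rewrite !ffunE.
  by case: ifP; rewrite ?addr0.
rewrite -phi_u; congr phi; apply/ffunP => i; rewrite !ffunE.
by case: eqP => [->|]; rewrite ?mulr0.
Qed.

End Filiform.

Lemma filiform_anosov_data k m :
  @anosov_data (filiform (selmer k) m) _ (coord_ffun (@coord_npoly _))
    (weighted_scale (qpolyX (selmer k))) (weighted_scale (eps_inv k)).
Proof.
split.
- by apply: coord_system_ffun; apply: coord_system_npoly.
- exact: weighted_scale_linear.
- exact: weighted_scale_lie.
- by apply: weighted_scaleK; apply: eps_invl.
- by apply: weighted_scaleK; rewrite mulrC; apply: eps_invl.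
- move=> f f_int [i j]; rewrite /coord_ffun /= ffunE.
  by apply: integral_epsX => j'; apply: (f_int (i, j')).
- move=> f f_int [i j]; rewrite /coord_ffun /= ffunE.
  by apply: integral_eps_invX => j'; apply: (f_int (i, j')).
by apply: weighted_scale_unit_free => n; apply: eps_unit_free.
Qed.

(** * Dimensions *)

(** The properties are recorded in the forms that are additive under direct
    sums, not through [anosov] and [without_abelian_factor]. *)
Definition anosov_dim (n : nat) : Prop :=
  exists (L : lieAlgType rat) (I : finType) (c : I -> L -> rat) A B,
    [/\ #|I| = n, anosov_data c A B & center_of_brackets L].

Lemma anosov_dimD p q : anosov_dim p -> anosov_dim q -> anosov_dim (p + q).
Proof.
move=> [L [I [c [A [B [<- dat cen]]]]]] [M [J [c' [A' [B' [<- dat' cen']]]]]].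
exists (L * M)%type, (I + J)%type; do 3 eexists; split.
- exact: card_sum.
- exact: anosov_data_sum dat dat'.
- exact: center_of_brackets_sum.
Qed.

Lemma anosov_dim_filiform k m : anosov_dim (m.+3 * k.+2).
Proof.
exists (filiform (selmer k) m.+2); do 4 eexists; split.
- 2: exact: filiform_anosov_data.
- by rewrite card_prod !card_ord mk_monic_selmer size_selmer.
- exact: filiform_center.
Qed.

Lemma anosov_dim_even d : ~~ odd d -> (6 <= d)%N -> anosov_dim d.
Proof.
move=> d_even d_ge6; have := anosov_dim_filiform 0 (d./2 - 3).
by rewrite -addn3 subnK ?muln2 ?even_halfK //; apply: half_leq d_ge6.
Qed.

Theorem mainTheorem4 (d : nat) (hd : (6 <= d)%N)
    (hd' : d \notin [:: 7; 11; 13]%N) :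
  exists L : lieAlgType rat,
    [/\ \dim {:L} = d, anosov L & without_abelian_factor L].
Proof.
suff [L [I [c [A [B [<- dat cen]]]]]] : anosov_dim d.
  exists L; have [] := anosov_of_data dat.
  by split=> //; apply: center_without_abelian_factor.
case d_odd: (odd d); last by apply: anosov_dim_even; rewrite ?d_odd.
have [-> | d_neq9] := eqVneq d 9; first exact: (anosov_dim_filiform 1 0).
have d_ge15 : (15 <= d)%N.
  by move: hd hd' d_odd d_neq9; do 15 case: d => [//|d].
rewrite -(subnK (leq_trans _ d_ge15 : 9 <= d)%N) //.
apply: anosov_dimD (anosov_dim_filiform 1 0); apply: anosov_dim_even.
  by rewrite oddB ?d_odd // (leq_trans _ d_ge15).
by rewrite leq_subRL // (leq_trans _ d_ge15).
Qed.
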